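(* Let $S$ be a Kato surface of intermediate type, let $D$ be its maximal reduced divisor of rational curves, and assume $0<\mu<2$, namely $k^{-1}<|\lambda|<1$. Let $\Theta=dz+B\,dw$ be any smooth $\Gamma$-equivariant vertical $(1,0)$-form on $X$. For every $M>0$, set $A(t):=2-\mu+e^{-t}\bigl(M-(2-\mu)\bigr)$ and $$\Omega_t^M:=A(t)\,\omega_{\rm tr}+e^{-t}s^\mu\sqrt{-1}\,\Theta\wedge\overline\Theta ,\qquad t\ge0 .$$ Then (the $\Gamma$-invariant form) $\Omega_t^M$ defines a smooth Hermitian metric on $S\setminus D$. It solves the normalised Chern--Ricci flow $$\partial_t\Omega_t^M=-\operatorname{Ric}(\Omega_t^M)-\Omega_t^M$$ with initial value $\Omega_0^M=M\omega_{\rm tr}+s^\mu\sqrt{-1}\,\Theta\wedge\overline\Theta$. Furthermore, $$\Omega_t^M\longrightarrow(2-\mu)\,\omega_{\rm tr}\quad\text{in }\mathcal C^\infty_{\rm loc}(S\setminus D)\quad\text{as }t\to+\infty .$$ The limiting form is semipositive of rank one, and its kernel is the canonical foliation.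
   Context: Convention. For a Hermitian metric $\omega=\sqrt{-1}\,g_{j\bar k}\,dz^j\wedge d\bar z^k$, the Chern--Ricci form is locally $\operatorname{Ric}(\omega)=-\sqrt{-1}\,\partial\overline\partial\log\det(g_{j\bar k})$. Intermediate surfaces. A Kato surface is a minimal compact complex surface of class VII with $b_2>0$ containing a global spherical shell; it is of intermediate type if its rational curves consist of a single cycle together with at least one tree of rational curves meeting the cycle. Let $r=\operatorname{ind}(S)$ be its index. By Dloussky--Oeljeklaus--Toma and Oeljeklaus--Toma, the universal cover of $S\setminus D$ is $X=\mathbb H_\ell\times\mathbb C$, $\mathbb H_\ell=\{w\in\mathbb C:\Re w<0\}$, with coordinates $(w,z)$, and the deck group $\Gamma$ is generated by $$T(w,z)=(w+2\pi\sqrt{-1},z),\qquad G(w,z)=(kw,\lambda z+h(w)),$$ and, if $r>1$, also $\varphi(w,z)=(w-\tfrac{2\pi\sqrt{-1}}{r},\xi z)$. Here $k\ge2$ is an integer, $\lambda\in\mathbb C^*$, $h(w)=Q(e^{-w})$ for a polynomial $Q$, and $\xi=e^{2\pi\sqrt{-1}\sigma_0/r}$ with $\sigma_0$ the largest exponent occurring in $Q$. Every $\gamma\in\Gamma$ has the form $\gamma(w,z)=(a_\gamma w+b_\gamma,\lambda_\gamma z+h_\gamma(w))$ with $a_\gamma>0$, $\lambda_\gamma\in\mathbb C^*$, $h_\gamma$ holomorphic on $\mathbb H_\ell$. The canonical foliation on $S\setminus D$ is induced by the distribution $\ker dw=\mathbb C\,\partial_z$ on $X$. Notation. $\mu:=-\frac{2\log|\lambda|}{\log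 k}$ (so $k^\mu|\lambda|^2=1$); $s:=-\Re w>0$; $\omega_{\rm tr}:=\sqrt{-1}\,\partial\overline\partial(-\log s)=\frac{\sqrt{-1}}{4s^2}dw\wedge d\bar w$, which is $\Gamma$-invariant. A smooth $\Gamma$-equivariant vertical $(1,0)$-form is a $(1,0)$-form $\Theta=dz+B\,dw$ with $B\in\mathcal C^\infty(X,\mathbb C)$ such that $\gamma^*\Theta=\lambda_\gamma\Theta$ for all $\gamma\in\Gamma$. Forms on $S\setminus D$ are identified with $\Gamma$-invariant forms on $X$. *)

(* Defs.v *)
From HB Require Import structures.
From mathcomp Require Import all_boot all_order all_algebra.
From mathcomp Require Import sesquilinear spectral complex.
From mathcomp Require Import all_classical all_reals all_analysis.

Set Implicit Arguments.
Unset Strict Implicit.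
Unset Printing Implicit Defensive.

Import Order.TTheory GRing.Theory Num.Theory.
Import numFieldNormedType.Exports.

Local Open Scope classical_set_scope.
Local Open Scope ring_scope.
Local Open Scope complex_scope.
Local Open Scope sesquilinear_scope.

Section ComplexCalculus.
Variable R : realType.
Local Notation C := R[i].
Local Notation re := (@complex.Re R).
Local Notation im := (@complex.Im R).

(* C^2 with its real normed-space structure: the point (w, z) is stored as
   ((Re w, Im w), (Re z, Im z)), since R[i] carries no topology. *)
Local Notation V := ((R * R) * (R * R))%type.
Implicit Types (p v : V) (U : set V) (vs : seq V) (j k : 'I_2).

Definition pt (w z : C) : V := ((re w, im w), (re z, im z)).
Definition cw p : C := p.1.1 +i* p.1.2.
Definition cz p : C := p.2.1 +i* p.2.2.

(* The index 0 : 'I_2 stands for w and 1 : 'I_2 for z. *)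
Definition zcoord j p : C := if j == 0 then cw p else cz p.
Definition evec j (a : C) : V := if j == 0 then pt a 0 else pt 0 a.

Definition cexp (a : C) : C :=
  (expR (re a) * cos (im a)) +i* (expR (re a) * sin (im a)).

Definition derivs vs (f : V -> R) : V -> R :=
  foldr (fun v (g : V -> R) => 'D_v g) f vs.

(* C^oo on an open set U: all iterated real directional derivatives exist and
   are continuous at the points of U. *)
Definition smooth_on U (f : V -> R) : Prop :=
  forall vs p, U p ->
    {for p, continuous (derivs vs f)} /\ forall v, derivable (derivs vs f) p v.

Definition csmooth_on U (f : V -> C) : Prop :=
  smooth_on U (re \o f) /\ smooth_on U (im \o f).

Definition cD v (f : V -> C) p : C := 'D_v (re \o f) p +i* 'D_v (im \o f) p.

(* Wirtinger operators: d/dz^j and d/dbar z^j. *)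
Definition dhol j (f : V -> C) p : C :=
  2^-1 * (cD (evec j 1) f p - 'i * cD (evec j 'i) f p).
Definition dbar j (f : V -> C) p : C :=
  2^-1 * (cD (evec j 1) f p + 'i * cD (evec j 'i) f p).

(* A (1,0)-form sum_j th_j dz^j is the row of its coefficients; a (1,1)-form
   sqrt(-1) sum_{j,k} g_{j kbar} dz^j /\ dbar z^k is the matrix (g_{j kbar}). *)
Definition form10 := V -> 'rV[C]_2.
Definition form11 := V -> 'M[C]_2.

Definition dw : form10 := fun=> delta_mx 0 0.
Definition dz : form10 := fun=> delta_mx 0 1.

(* sqrt(-1) th /\ conj th *)
Definition iwedge (th : form10) : form11 :=
  fun p => (th p)^T *m map_mx Num.conj (th p).

(* sqrt(-1) d dbar f *)
Definition iddbar (f : V -> R) : form11 :=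
  fun p => \matrix_(j, k) dhol j (dbar k (fun q => (f q)%:C)) p.

(* For g Hermitian, \det g is real. *)
Definition chern_ricci (g : form11) : form11 :=
  fun p => - iddbar (fun q => ln (re (\det (g q)))) p.

(* Pullback under a holomorphic map F (so only d/dz^j occurs). *)
Definition hol_jacobian (F : V -> V) p : 'M[C]_2 :=
  \matrix_(l, j) dhol j (zcoord l \o F) p.
Definition pullback10 (F : V -> V) (th : form10) : form10 :=
  fun p => th (F p) *m hol_jacobian F p.
Definition pullback11 (F : V -> V) (g : form11) : form11 :=
  fun p => (hol_jacobian F p)^T *m g (F p) *m map_mx Num.conj (hol_jacobian F p).

Definition form11_smooth_on U (g : form11) : Prop :=
  forall j k, csmooth_on U (fun p => g p j k).

(* Value on (v, conj v), for the (1,0)-vector v = v_0 d/dw + v_1 d/dz. *)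
Definition hform (g : form11) p (v u : 'rV[C]_2) : C :=
  (v *m g p *m u ^t*) 0 0.

Definition positive_definite_at (g : form11) p : Prop :=
  g p \is hermsymmx /\ forall v : 'rV[C]_2, v != 0 -> 0 < hform g p v v.
Definition semipositive_at (g : form11) p : Prop :=
  g p \is hermsymmx /\ forall v : 'rV[C]_2, 0 <= hform g p v v.
Definition form_kernel (g : form11) p : set 'rV[C]_2 :=
  [set v | forall u, hform g p v u = 0].

(* One-sided at t = 0. *)
Definition has_time_derivative (f : R -> R) (t l : R) : Prop :=
  (u - t)^-1 * (f u - f t) @[u --> within `[0, +oo[ t^'] --> l.

(* d/dt g_t = - Ric(g_t) - g_t on U, for all t >= 0. *)
Definition normalised_chern_ricci_flow_on U (g : R -> form11) : Prop :=
  forall t p j k, 0 <= t -> U p ->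
    let rhs := (- chern_ricci (g t) p - g t p) j k in
    has_time_derivative (fun u => re (g u p j k)) t (re rhs) /\
    has_time_derivative (fun u => im (g u p j k)) t (im rhs).

(* Locally uniform convergence on U, with all derivatives, as t --> +oo. *)
Definition cvg_smooth_loc_on U (g : R -> form11) (g_oo : form11) : Prop :=
  forall vs j k,
    {family compactly_in U,
      (fun t => derivs vs (fun p => re (g t p j k))) @ +oo -->
      derivs vs (fun p => re (g_oo p j k))} /\
    {family compactly_in U,
      (fun t => derivs vs (fun p => im (g t p j k))) @ +oo -->
      derivs vs (fun p => im (g_oo p j k))}.

End ComplexCalculus.

(* Normal form of the complement of the maximal divisor D of rational curves in
   an intermediate Kato surface S: S \ D = X / Gamma, with X and Gamma as
   defined below from these parameters (r is the index of S). *)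
Record intermediate_data (R : realType) := IntermediateData {
  kk : nat;
  kk_ge2 : (2 <= kk)%N;
  lam : R[i];
  lam_neq0 : lam != 0;
  QQ : {poly R[i]};
  QQ_neq0 : QQ != 0;
  rr : nat;
  rr_gt0 : (0 < rr)%N
}.

Section IntermediateSurface.
Variables (R : realType) (S : intermediate_data R).
Local Notation C := R[i].
Local Notation V := ((R * R) * (R * R))%type.
Implicit Types (p : V) (j k : 'I_2).

(* X = {Re w < 0} x C *)
Definition XX : set V := [set p | complex.Re (cw p) < 0].

Definition hh (w : C) : C := (QQ S).[cexp (- w)].

(* sigma_0 = deg Q *)
Definition sigma0 : nat := (size (QQ S)).-1.
Definition xi : C := cexp ((2 * pi * sigma0%:R / (rr S)%:R) *i).

(* The generators are given by entire formulas and are used as self-maps of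
   C^2; all of them preserve X. *)
Definition TT p : V := pt (cw p + (2 * pi) *i) (cz p).
Definition GG p : V := pt ((kk S)%:R * cw p) (lam S * cz p + hh (cw p)).
Definition phi p : V := pt (cw p - (2 * pi / (rr S)%:R) *i) (xi * cz p).

(* The group Gamma generated by T, G and, if r > 1, phi. *)
Inductive deck : (V -> V) -> Prop :=
| deck_id : deck id
| deck_T : deck TT
| deck_G : deck GG
| deck_phi : (1 < rr S)%N -> deck phi
| deck_comp g1 g2 : deck g1 -> deck g2 -> deck (g1 \o g2)
| deck_inv g g' : deck g -> cancel g g' -> cancel g' g -> deck g'.

(* gam (w, z) = (a w + b, l z + h w) on X; gam determines a, b, l and h on the
   half-plane, so that l is the multiplier lambda_gam (and h is holomorphic as
   soon as gam is). *)
Definition fibre_affine (gam : V -> V) (a : R) (b l : C) (h : C -> C) : Prop :=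
  [/\ 0 < a, l != 0 &
      forall p, XX p -> gam p = pt (a%:C * cw p + b) (l * cz p + h (cw p))].

Definition equivariant10 (th : form10 R) : Prop :=
  forall gam a b l h, deck gam -> fibre_affine gam a b l h ->
    forall p, XX p -> pullback10 gam th p = l *: th p.

Definition vertical_form (B : V -> C) : form10 R :=
  fun p => dz p + B p *: dw p.

Definition equivariant_vertical (B : V -> C) : Prop :=
  csmooth_on XX B /\ equivariant10 (vertical_form B).

(* Smooth (1,1)-forms on S \ D = X / Gamma. *)
Definition quotient_form11 (g : form11 R) : Prop :=
  form11_smooth_on XX g /\
  forall gam, deck gam -> forall p, XX p -> pullback11 gam g p = g p.

Definition quotient_hermitian_metric (g : form11 R) : Prop :=
  quotient_form11 g /\ forall p, XX p -> positive_definite_at g p.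

(* The (1,0)-part of ker dw, spanned by d/dz. *)
Definition canonical_foliation p : set 'rV[C]_2 :=
  [set v | (v *m (dw p)^T) 0 0 = 0].

Definition mu : R :=
  - (2 * ln (complex.Re `|lam S|)) / ln (kk S)%:R.

Definition ss p : R := - complex.Re (cw p).

Definition omega_tr : form11 R := iddbar (fun p => - ln (ss p)).

Definition AA (M t : R) : R := 2 - mu + expR (- t) * (M - (2 - mu)).

Definition Omega (B : V -> C) (M t : R) : form11 R := fun p =>
  (AA M t)%:C *: omega_tr p +
  (expR (- t) * ss p `^ mu)%:C *: iwedge (vertical_form B) p.

End IntermediateSurface.

(* Main.v *)
(* Every form in the theorem is a combination of the rank-one matrices
   [u^T conj u] attached to the (1,0)-forms [dw] and [Theta]. On [X] one has
   [omega_tr = (4 s^2)^-1 dw^T conj dw], so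
   [det Omega_t = A(t) e^-t s^(mu - 2) / 4] does not involve [B], and
   [Ric (Omega_t) = (2 - mu) i ddbar (log s) = - (2 - mu) omega_tr] is constant
   in time. Moreover [Omega_t = (2 - mu) omega_tr + e^-t Omega_decay] with
   [Omega_decay] independent of [t]; both the flow equation and the smooth
   convergence follow. Invariance under the deck group only uses that each deck
   transformation is [(a w + b, l z + h w)] with [b] imaginary and
   [a^mu |l|^2 = 1]. *)
Require Import Defs.
From HB Require Import structures.
From mathcomp Require Import all_boot all_order all_algebra.
From mathcomp Require Import sesquilinear spectral complex.
From mathcomp Require Import all_classical all_reals all_analysis.
From mathcomp Require Import ring.

Set Implicit Arguments.
Unset Strict Implicit.
Unset Printing Implicit Defensive.

Import Order.TTheory GRing.Theory Num.Theory.
Import numFieldNormedType.Exports.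

Local Open Scope classical_set_scope.
Local Open Scope ring_scope.
Local Open Scope complex_scope.

(** * Smooth real functions on an open set: closure properties, and convergence of [f + e^-t g] with
    all derivatives *)

Section SmoothFunctions.
Variable R : realType.
Local Notation V := ((R * R) * (R * R))%type.
Implicit Types (p v : V) (U : set V) (f g : V -> R) (vs : seq V).

(** The last vector of the list is the derivative taken first. Peeling it off replaces [f] by
    ['D_v f], which suits inductions that keep the function inside a class closed under
    differentiation. *)
Lemma derivs_rcons vs v f : derivs (rcons vs v) f = derivs vs ('D_v f).
Proof. by rewrite /derivs foldr_rcons. Qed.

Lemma near_eq_on_open U f g p : open U -> (forall q, U q -> f q = g q) ->
  U p -> \forall q \near p, f q = g q.
Proof.
move=> oU fg Up; have : nbhs p U by exact: open_nbhs_nbhs.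
by apply: filterS => q; exact: fg.
Qed.

Lemma eq_on_derive U f g v : open U -> (forall q, U q -> f q = g q) ->
  forall p, U p -> 'D_v f p = 'D_v g p.
Proof.
by move=> oU fg p Up; apply: near_eq_derive; exact: near_eq_on_open fg Up.
Qed.

Lemma eq_on_derivs U f g vs : open U -> (forall q, U q -> f q = g q) ->
  forall p, U p -> derivs vs f p = derivs vs g p.
Proof. by move=> oU fg; elim: vs => //= v vs IH; exact: eq_on_derive. Qed.

Lemma smooth_on_continuous U f p : smooth_on U f -> U p ->
  {for p, continuous f}.
Proof. by move=> sf Up; have [] := sf [::] p Up. Qed.

Lemma smooth_on_derivable U f p v : smooth_on U f -> U p -> derivable f p v.
Proof. by move=> sf Up; have [_] := sf [::] p Up; exact. Qed.

Lemma smooth_on_derive U f v : smooth_on U f -> smooth_on U ('D_v f).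
Proof. by move=> sf vs p Up; rewrite -derivs_rcons; exact: sf. Qed.

Lemma near_eq_continuous f g p : (\forall q \near p, f q = g q) ->
  {for p, continuous f} -> {for p, continuous g}.
Proof.
move=> fg cf; rewrite /prop_for/continuous_at -(nbhs_singleton fg).
by apply: cvg_trans cf; exact: near_eq_cvg.
Qed.

Lemma eq_on_smooth U f g : open U -> (forall q, U q -> f q = g q) ->
  smooth_on U f -> smooth_on U g.
Proof.
move=> oU fg sf vs p Up; have [cf df] := sf vs p Up.
have E := near_eq_on_open oU (eq_on_derivs vs oU fg) Up.
split=> [|v]; first exact: near_eq_continuous E cf.
exact: near_eq_derivable (df v).
Qed.

(* Iterated derivatives are computed only up to equality on [U], so stability
   of [P] under differentiation is also only required up to equality on [U]. *)
Lemma smooth_on_coind (P : (V -> R) -> Prop) U : open U ->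
  (forall f, P f -> forall p, U p ->
     {for p, continuous f} /\ forall v, derivable f p v) ->
  (forall f, P f -> forall v, exists2 g, P g & forall p, U p -> 'D_v f p = g p) ->
  forall f, P f -> smooth_on U f.
Proof.
move=> oU P0 P1 f Pf vs; elim/last_ind: vs f Pf => [|vs v IH] f Pf p Up.
  exact: P0.
have [g Pg fg] := P1 f Pf v; rewrite derivs_rcons.
have gf q : U q -> g q = 'D_v f q by move=> Uq; rewrite fg.
have [cg dg] := IH g Pg p Up.
have E := near_eq_on_open oU (eq_on_derivs vs oU gf) Up.
split=> [|w]; first exact: near_eq_continuous E cg.
exact: near_eq_derivable (dg w).
Qed.

(** By the Leibniz rule, the derivative of a product of smooth functions is a sum of products. The
    class generated by smooth functions under both operations is therefore stable under ['D_v] on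
    [U], whereas products alone are not. *)
Inductive ring_of_smooth U : (V -> R) -> Prop :=
| ros_smooth f : smooth_on U f -> ring_of_smooth U f
| ros_add f g : ring_of_smooth U f -> ring_of_smooth U g ->
    ring_of_smooth U (f + g)
| ros_mul f g : ring_of_smooth U f -> ring_of_smooth U g ->
    ring_of_smooth U (f * g).

Lemma ring_of_smooth_smooth U f : open U -> ring_of_smooth U f -> smooth_on U f.
Proof.
move=> oU; have reg g : ring_of_smooth U g -> forall p, U p ->
    {for p, continuous g} /\ forall v, derivable g p v.
  elim=> {g}[g sg p Up|g h _ IHg _ IHh p Up|g h _ IHg _ IHh p Up].
  - by split=> [|v]; [exact: smooth_on_continuous sg Up|
                      exact: smooth_on_derivable sg Up].
  - have [[cg dg] [ch dh]] := (IHg p Up, IHh p Up).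
    by split=> [|v]; [exact: continuousD|exact: derivableD].
  - have [[cg dg] [ch dh]] := (IHg p Up, IHh p Up).
    by split=> [|v]; [exact: continuousM|exact: derivableM].
apply: smooth_on_coind => // {}f Pf v.
elim: f / Pf => [f sf|f g Pf [f' Pf' ff'] Pg [g' Pg' gg']|
                  f g Pf [f' Pf' ff'] Pg [g' Pg' gg']].
- by exists ('D_v f) => //; apply: ros_smooth; exact: smooth_on_derive.
- exists (f' + g') => [|p Up]; first exact: ros_add.
  have [[_ df] [_ dg]] := (reg _ Pf p Up, reg _ Pg p Up).
  by rewrite deriveD// ff'// gg'.
- exists (f * g' + g * f') => [|p Up].
    by apply: ros_add; exact: ros_mul.
  have [[_ df] [_ dg]] := (reg _ Pf p Up, reg _ Pg p Up).
  by rewrite deriveM// ff'// gg'.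
Qed.

Lemma smooth_onD U f g : open U -> smooth_on U f -> smooth_on U g ->
  smooth_on U (fun p => f p + g p).
Proof.
move=> oU sf sg; apply: (@ring_of_smooth_smooth U (f + g)) => //.
by apply: ros_add; exact: ros_smooth.
Qed.

Lemma smooth_onM U f g : open U -> smooth_on U f -> smooth_on U g ->
  smooth_on U (fun p => f p * g p).
Proof.
move=> oU sf sg; apply: (@ring_of_smooth_smooth U (f * g)) => //.
by apply: ros_mul; exact: ros_smooth.
Qed.

Lemma smooth_on_cst U (c : R) : open U -> smooth_on U (fun=> c).
Proof.
move=> oU; apply: (@smooth_on_coind (fun f => exists c, f = cst c)) => //.
- move=> _ [{}c ->] p Up; split; first exact: cvg_cst.
  by move=> v; exact: derivable_cst.
- move=> _ [{}c ->] v; exists (cst 0); first by exists 0.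
  by move=> p _; rewrite derive_cst.
- by exists c.
Qed.

Lemma smooth_onN U f : open U -> smooth_on U f -> smooth_on U (fun p => - f p).
Proof.
move=> oU sf; apply: (@eq_on_smooth U (fun p => -1 * f p)) => //.
  by move=> q _; rewrite mulN1r.
by apply: smooth_onM => //; exact: smooth_on_cst.
Qed.

(** Here [c] is constant in space; it will be [e^-t]. *)
Lemma derivs_affine U f g (c : R) vs :
  open U -> smooth_on U f -> smooth_on U g ->
  forall p, U p -> derivs vs (fun q => f q + c * g q) p =
                   derivs vs f p + c * derivs vs g p.
Proof.
move=> oU sf sg; elim: vs => //= v vs IH p Up.
rewrite (eq_on_derive v oU IH Up).
have [_ df] := sf vs p Up; have [_ dg] := sg vs p Up.
rewrite [LHS](_ : _ = 'D_v (derivs vs f + c \*: derivs vs g) p)//.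
by rewrite deriveD ?deriveZ//; apply: derivableZ.
Qed.

(** The difference from the limit is [e^-t derivs vs g], and the continuous function [derivs vs g]
    is bounded on each compact subset of [U]. *)
Lemma cvg_derivs_expN U f g vs : open U -> smooth_on U f -> smooth_on U g ->
  {family compactly_in U,
    (fun t : R => derivs vs (fun p => f p + expR (- t) * g p)) @ +oo -->
    derivs vs f}.
Proof.
move=> oU sf sg; apply/fam_cvgP => K [KU cK].
have [N [Nr Ng]] : bounded_set (derivs vs g @` K).
  apply: compact_bounded; apply: continuous_compact => //.
  apply: continuous_in_subspaceT => p /set_mem /KU Up.
  by have [] := sg vs p Up.
(* Boundedness supplies a bound for every number strictly above [N]; this one is moreover positive,
   so one may divide by it. *)
set N1 := `|N| + 1.
have N1g p : K p -> `|derivs vs g p| <= N1.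
  move=> Kp; apply: (Ng N1); last by exists p.
  by rewrite /N1; apply: (le_lt_trans (ler_norm N)); rewrite ltrDl.
have N1_gt0 : 0 < N1 by rewrite /N1 ltr_wpDl.
move=> P /uniform_nbhs [E [+ subP]].
rewrite -entourage_ballE => -[/= e e0 subE].
have : \forall t \near +oo, expR (- t) * N1 < e.
  (* The inequality amounts to [t > - ln (e / N1)]. *)
  near=> t; rewrite -ltr_pdivlMr// -ltr_ln ?posrE ?expR_gt0 ?divr_gt0//.
  by rewrite expRK ltrNl; near: t; apply: nbhs_pinfty_gt; exact: num_real.
apply: filterS => t te; apply: subP => p Kp; apply: subE => /=.
have Up := KU _ Kp.
rewrite /ball /= (derivs_affine _ vs oU sf sg Up) opprD addNKr normrN normrM.
by apply: le_lt_trans te; rewrite ger0_norm ?expR_ge0// ler_wpM2l ?expR_ge0// N1g.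
Unshelve. all: by end_near. Qed.

End SmoothFunctions.

(** * Complex-valued smooth functions and locality of the Wirtinger operators *)

Section ComplexSmoothFunctions.
Variable R : realType.
Local Notation C := R[i].
Local Notation V := ((R * R) * (R * R))%type.
Local Notation re := (@complex.Re R).
Local Notation im := (@complex.Im R).
Local Notation X := (@XX R).
Implicit Types (p v : V) (U : set V) (f g : V -> C) (j k : 'I_2).

Lemma Re_add (a b : C) : re (a + b) = re a + re b.
Proof. by case: a b => ? ? []. Qed.

Lemma Im_add (a b : C) : im (a + b) = im a + im b.
Proof. by case: a b => ? ? []. Qed.

Lemma Re_mul (a b : C) : re (a * b) = re a * re b - im a * im b.
Proof. by case: a b => ? ? []. Qed.

Lemma Im_mul (a b : C) : im (a * b) = re a * im b + im a * re b.
Proof. by case: a b => ? ? []. Qed.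

Lemma Re_scale (c : R) (a : C) : re (c%:C * a) = c * re a.
Proof. by rewrite Re_mul/= mul0r subr0. Qed.

Lemma Im_scale (c : R) (a : C) : im (c%:C * a) = c * im a.
Proof. by rewrite Im_mul/= mul0r addr0. Qed.

Lemma eq_on_csmooth U f g : open U -> (forall q, U q -> f q = g q) ->
  csmooth_on U f -> csmooth_on U g.
Proof.
move=> oU fg [sr si]; split.
  by apply: eq_on_smooth sr => // q Uq /=; rewrite fg.
by apply: eq_on_smooth si => // q Uq /=; rewrite fg.
Qed.

Lemma csmooth_onD U f g : open U -> csmooth_on U f -> csmooth_on U g ->
  csmooth_on U (fun p => f p + g p).
Proof.
move=> oU [fr fi] [gr gi]; split.
  apply: eq_on_smooth (smooth_onD oU fr gr) => // q _.
  by rewrite /= Re_add.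
apply: eq_on_smooth (smooth_onD oU fi gi) => // q _.
by rewrite /= Im_add.
Qed.

Lemma csmooth_onM U f g : open U -> csmooth_on U f -> csmooth_on U g ->
  csmooth_on U (fun p => f p * g p).
Proof.
move=> oU [fr fi] [gr gi]; split.
  have s := smooth_onD oU (smooth_onM oU fr gr)
              (smooth_onN oU (smooth_onM oU fi gi)).
  by apply: eq_on_smooth s => // q _; rewrite /= Re_mul.
have s := smooth_onD oU (smooth_onM oU fr gi) (smooth_onM oU fi gr).
by apply: eq_on_smooth s => // q _; rewrite /= Im_mul.
Qed.

Lemma csmooth_on_real U (f : V -> R) : open U -> smooth_on U f ->
  csmooth_on U (fun p => (f p)%:C).
Proof. by move=> oU sf; split; [exact: sf|exact: smooth_on_cst]. Qed.

Lemma csmooth_on_cst U (c : C) : open U -> csmooth_on U (fun=> c).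
Proof. by move=> oU; split; exact: smooth_on_cst. Qed.

Lemma csmooth_on_conj U f : open U -> csmooth_on U f ->
  csmooth_on U (fun p => Num.conj (f p)).
Proof.
move=> oU [fr fi]; split.
  by apply: eq_on_smooth fr => // q _ /=; case: (f q).
by apply: eq_on_smooth (smooth_onN oU fi) => // q _ /=; case: (f q).
Qed.

Lemma eq_on_cD U f g v p : open U -> (forall q, U q -> f q = g q) -> U p ->
  cD v f p = cD v g p.
Proof.
move=> oU fg Up; rewrite /cD.
by congr (_ +i* _); apply: eq_on_derive Up => // q Uq /=; rewrite fg.
Qed.

Lemma eq_on_dhol U f g j p : open U -> (forall q, U q -> f q = g q) -> U p ->
  dhol j f p = dhol j g p.
Proof. by move=> oU fg Up; rewrite /dhol !(eq_on_cD _ oU fg Up). Qed.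

Lemma eq_on_dbar U f g j p : open U -> (forall q, U q -> f q = g q) -> U p ->
  dbar j f p = dbar j g p.
Proof. by move=> oU fg Up; rewrite /dbar !(eq_on_cD _ oU fg Up). Qed.

Lemma iddbarE (f : V -> R) p j k :
  iddbar f p j k = dhol j (dbar k (fun q => (f q)%:C)) p.
Proof. by rewrite mxE. Qed.

Lemma eq_on_iddbar U (f g : V -> R) p : open U ->
  (forall q, U q -> f q = g q) -> U p -> iddbar f p = iddbar g p.
Proof.
move=> oU fg Up; rewrite /iddbar; apply: eq_mx => j k.
apply: (eq_on_dhol j oU _ Up) => q Uq; apply: (eq_on_dbar k oU _ Uq) => x Ux.
by rewrite fg.
Qed.

Lemma cD_real (f : V -> R) v p : cD v (fun q => (f q)%:C) p = ('D_v f p)%:C.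
Proof.
by rewrite /cD; congr (_ +i* _); rewrite (_ : _ \o _ = cst 0)// derive_cst.
Qed.

(** * The domain [X] and functions of [s = - Re w] alone *)

Lemma open_XX : open X.
Proof.
rewrite (_ : X = (fun p : V => p.1.1) @^-1` [set x | x < 0])//.
apply: open_comp; last exact: open_lt.
move=> p _; apply: (@continuous_comp _ _ _ (fst : V -> R * R) fst).
  exact: cvg_fst.
exact: cvg_fst.
Qed.

Lemma ss_gt0 p : X p -> 0 < ss p.
Proof. by rewrite /XX/ss/= oppr_gt0. Qed.

Lemma continuous_ss : continuous (@ss R).
Proof.
move=> p; apply: (@continuousN _ _ _ (fun p : V => p.1.1)).
apply: (@continuous_comp _ _ _ (fst : V -> R * R) fst); exact: cvg_fst.
Qed.

Lemma is_derive_dir (F : R -> R) (x l u : R) :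
  is_derive x 1 F l -> is_derive x u F (u * l).
Proof.
case=> dF <-; have /derivable1_diffP dfF := dF.
apply: DeriveDef; first exact: diff_derivable.
by rewrite !deriveE// -[Y in 'd F x Y]mulr1 linearZ.
Qed.

Lemma is_derive_comp_linear (u : V -> R) (F : R -> R) (l : R) p v :
  (forall h q w, u (h *: q + w) = h * u q + u w) ->
  is_derive (u p) 1 F l -> is_derive p v (F \o u) (u v * l).
Proof.
move=> lin_u /(is_derive_dir (u v))[dF <-].
have E : (fun h : R => h^-1 *: ((F \o u) (h *: v + p) - (F \o u) p)) =
         (fun h : R => h^-1 *: (F (h *: u v + u p) - F (u p))).
  by apply/funext => h /=; rewrite lin_u.
by apply: DeriveDef; rewrite /derivable /derive E.
Qed.

Lemma is_derive_comp_ss (F : R -> R) (l : R) p v :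
  is_derive (ss p) 1 F l -> is_derive p v (F \o @ss R) (- v.1.1 * l).
Proof.
apply: (is_derive_comp_linear (u := @ss R)) => h q w.
by rewrite /ss/= opprD mulrN.
Qed.

(** The family of all [c s^b] is stable under directional derivatives: along [v], the function
    [c s^b] becomes [- v.1.1 c b s^(b-1)]. *)
Lemma smooth_on_powR (a : R) : smooth_on X (fun p => ss p `^ a).
Proof.
pose P (f : V -> R) := exists c b, f = fun p => c * ss p `^ b.
apply: (smooth_on_coind (P := P)).
- exact: open_XX.
- move=> _ [c [b ->]] p Xp.
  have H : is_derive (ss p) 1 (fun x => c * x `^ b) (c * (b * ss p `^ (b - 1))).
    exact/is_deriveZ/is_derive1_powR/ss_gt0.
  split=> [|v]; last by case: (is_derive_comp_ss v H).
  apply: (@continuous_comp _ _ _ (@ss R) (fun x => c * x `^ b)).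
    exact: continuous_ss.
  case: H => dH _; apply: differentiable_continuous.
  exact/derivable1_diffP.
- move=> _ [c [b ->]] v.
  exists (fun p => (- v.1.1 * (c * b)) * ss p `^ (b - 1)).
    by exists (- v.1.1 * (c * b)), (b - 1).
  move=> p Xp.
  have H : is_derive (ss p) 1 (fun x => c * x `^ b) (c * (b * ss p `^ (b - 1))).
    exact/is_deriveZ/is_derive1_powR/ss_gt0.
  by case: (is_derive_comp_ss v H) => _ ->; rewrite !mulrA.
- by exists 1, a; apply/funext => p; rewrite mul1r.
Qed.

Lemma evec1_coord j : (@evec R j 1).1.1 = (j == 0)%:R.
Proof. by rewrite /evec; case: eqP. Qed.

Lemma eveci_coord j : (@evec R j 'i).1.1 = 0.
Proof. by rewrite /evec; case: eqP. Qed.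

Lemma half_real (x : R) : 2^-1 * x%:C = (2^-1 * x)%:C.
Proof. by rewrite rmorphM/= fmorphV rmorph_nat. Qed.

(** The direction ['i] leaves [s] fixed and [s] falls at unit speed along [Re w], so both Wirtinger
    derivatives in [w] equal [- F'(s) / 2], and those in [z] vanish. *)
Lemma dhol_comp_ss (F : R -> R) (l : R) j p : is_derive (ss p) 1 F l ->
  dhol j (fun q => (F (ss q))%:C) p = (2^-1 * (- (j == 0)%:R * l))%:C.
Proof.
move=> H; rewrite /dhol !(cD_real (F \o @ss R)).
have [_ ->] := is_derive_comp_ss (evec j 1) H.
have [_ ->] := is_derive_comp_ss (evec j 'i) H.
by rewrite evec1_coord eveci_coord oppr0 mul0r mulr0 subr0 half_real.
Qed.

Lemma dbar_comp_ss (F : R -> R) (l : R) j p : is_derive (ss p) 1 F l ->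
  dbar j (fun q => (F (ss q))%:C) p = (2^-1 * (- (j == 0)%:R * l))%:C.
Proof.
move=> H; rewrite /dbar !(cD_real (F \o @ss R)).
have [_ ->] := is_derive_comp_ss (evec j 1) H.
have [_ ->] := is_derive_comp_ss (evec j 'i) H.
by rewrite evec1_coord eveci_coord oppr0 mul0r mulr0 addr0 half_real.
Qed.

Lemma iddbar_comp_ss (F F' F'' : R -> R) p :
  (forall x : R, 0 < x -> is_derive x 1 F (F' x)) ->
  (forall x : R, 0 < x -> is_derive x 1 F' (F'' x)) -> X p ->
  iddbar (F \o @ss R) p = (4^-1 * F'' (ss p))%:C *: delta_mx 0 0.
Proof.
move=> dF dF' Xp; apply/matrixP => j k; rewrite [LHS]iddbarE.
(* The inner [dbar] has to be known on all of the open set [X], not only at [p], before it can be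
   differentiated again. *)
rewrite (@eq_on_dhol X _
  (fun q => (2^-1 * (- (k == 0)%:R * F' (ss q)))%:C) _ _ open_XX _ Xp); last first.
  by move=> q Xq; rewrite (dbar_comp_ss k (dF _ (ss_gt0 Xq))).
have H : is_derive (ss p) 1 (fun x => 2^-1 * (- (k == 0)%:R * F' x))
    (2^-1 * (- (k == 0)%:R * F'' (ss p))).
  by apply: is_deriveZ; apply: is_deriveZ; exact: dF' (ss_gt0 Xp).
rewrite (dhol_comp_ss j H).
rewrite [in RHS]mxE [in RHS]mxE.
rewrite -[Y in _ = _ * Y](rmorph_nat (real_complex R)) -rmorphM/=; congr _%:C.
by case: (j == 0); case: (k == 0) => /=; field.
Qed.

Lemma is_deriveVr (x : R) : 0 < x -> is_derive x 1 (@GRing.inv R) (- x ^- 2).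
Proof.
move=> x0; have x1 : x != 0 by rewrite gt_eqF.
apply: DeriveDef; first exact: (derivableV (f := id)).
by rewrite (deriveV (f := id))// derive_id /GRing.scale/= mulr1.
Qed.

(** Serves two potentials: [- ln s], which gives [omega_tr], and the logarithm of the determinant of
    [Omega], where [c] absorbs everything depending on time only. *)
Lemma iddbar_ln_ss (c a : R) p : X p ->
  iddbar (fun q => c + a * ln (ss q)) p =
  (- a * (4^-1 * ss p ^- 2))%:C *: delta_mx 0 0.
Proof.
move=> Xp.
have dF (x : R) : 0 < x -> is_derive x 1 (fun x => c + a * ln x) (a * x^-1).
  move=> x0; rewrite -[Y in is_derive _ _ _ Y]add0r.
  by apply: is_deriveD; apply: is_deriveZ; exact: is_derive1_ln.
have dF' (x : R) : 0 < x -> is_derive x 1 (fun x => a * x^-1) (a * - x ^- 2).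
  by move=> x0; apply: is_deriveZ; exact: is_deriveVr.
rewrite [LHS](iddbar_comp_ss dF dF' Xp); congr (_%:C *: _); ring.
Qed.

Lemma omega_trE p : X p ->
  omega_tr p = (4^-1 * ss p ^- 2)%:C *: delta_mx 0 0.
Proof.
move=> Xp; rewrite -[Y in Y%:C]mul1r -[Y in (Y * _)%:C]opprK -(iddbar_ln_ss 0 (-1) Xp).
rewrite /omega_tr; congr (iddbar _ p); apply/funext => q.
by rewrite add0r mulN1r.
Qed.

End ComplexSmoothFunctions.

(** * Deck transformations and invariance of the two building blocks of the metric *)

Section DeckGroup.
Variables (R : realType) (S : intermediate_data R).
Local Notation C := R[i].
Local Notation V := ((R * R) * (R * R))%type.
Local Notation re := (@complex.Re R).
Local Notation im := (@complex.Im R).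
Local Notation X := (@XX R).
Implicit Types (p v : V) (j k : 'I_2).

Lemma ptK p : pt (cw p) (cz p) = p.
Proof. by case: p => [[? ?] [? ?]]. Qed.

Lemma cw_pt (w z : C) : cw (pt w z) = w.
Proof. by case: w. Qed.

Lemma cz_pt (w z : C) : cz (pt w z) = z.
Proof. by case: z. Qed.

(** Applied to the multiplier [xi] of [phi]: it yields both the modulus condition and [xi != 0]. *)
Lemma cexp_imag_norm (x : R) : cexp (x *i) * Num.conj (cexp (x *i)) = 1.
Proof.
rewrite /cexp/= expR0 !mul1r; apply/eqP; rewrite eq_complex/=; apply/andP; split.
  by rewrite mulrN opprK -!expr2 cos2Dsin2.
by apply/eqP; ring.
Qed.

Lemma kk_gt1 : 1 < (kk S)%:R :> R.
Proof. by rewrite ltr1n; exact: kk_ge2. Qed.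

(** The exponent [mu] is defined so that [mu ln k = - 2 ln |lam|]; dividing by [ln k] is legitimate
    because [k >= 2]. *)
Lemma powR_kk_mu :
  ((kk S)%:R `^ mu S)%:C * (lam S * Num.conj (lam S)) = 1 :> C.
Proof.
have k1 := kk_gt1; have k0 : 0 < (kk S)%:R :> R by rewrite (lt_trans ltr01).
set n := re `|lam S|.
have nE : `|lam S| = n%:C by rewrite /n RRe_real// normr_real.
have n0 : 0 < n by rewrite -ltcR -nE normr_gt0 lam_neq0.
rewrite -normCK nE -rmorphXn -rmorphM/= -[RHS](rmorph1 (real_complex R)).
congr _%:C; rewrite /powR gt_eqF// /mu -/n divfK ?gt_eqF ?ln_gt0//.
rewrite expRN mulr_natl mulr2n expRD lnK ?posrE// -expr2 mulVf//.
by rewrite expf_neq0// gt_eqF.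
Qed.

(** Induction on the generation of the group. The two conditions carried along are those that matter
    for the metric: [re b = 0] makes [s] scale exactly by [a], and [a^mu |l|^2 = 1] then makes
    [s^mu] compensate the factor [|l|^2] acquired by [iwedge Theta]. *)
Lemma deck_affine g : deck S g -> exists a b l h,
  [/\ 0 < a, re b = 0, l != 0, (a `^ mu S)%:C * (l * Num.conj l) = 1 &
      forall p, g p = pt (a%:C * cw p + b) (l * cz p + h (cw p))].
Proof.
have one_mu : ((1 : R) `^ mu S)%:C * (1 * Num.conj 1) = 1 :> C.
  by rewrite powR1 conjC1 !mulr1.
elim=> {g}[||| |g1 g2 _ [a1 [b1 [l1 [h1 [a10 b10 l10 m1 E1]]]]]
              _ [a2 [b2 [l2 [h2 [a20 b20 l20 m2 E2]]]]]
          |g g' _ [a [b [l [h [a0 b0 l0 m E]]]]] _ g'K].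
- exists 1, 0, 1, (fun=> 0).
  split; [exact: ltr01|by []|exact: oner_neq0|exact: one_mu|].
  by move=> p; rewrite !mul1r !addr0 ptK.
- exists 1, ((2 * pi) *i), 1, (fun=> 0).
  split; [exact: ltr01|by []|exact: oner_neq0|exact: one_mu|].
  by move=> p; rewrite !mul1r !addr0.
- exists (kk S)%:R, 0, (lam S), (hh S); split.
  + by rewrite (lt_trans ltr01)// kk_gt1.
  + by [].
  + exact: lam_neq0.
  + exact: powR_kk_mu.
  + by move=> p; rewrite addr0 rmorph_nat.
- move=> _; exists 1, (- ((2 * pi / (rr S)%:R) *i)), (xi S), (fun=> 0).
  have xiJ : xi S * Num.conj (xi S) = 1 by exact: cexp_imag_norm.
  split; [exact: ltr01|by rewrite /= oppr0| | |].
  + by apply: contra_eqN xiJ => /eqP ->; rewrite mul0r eq_sym oner_neq0.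
  + by rewrite powR1 mul1r.
  + by move=> p; rewrite mul1r addr0.
- exists (a1 * a2), (a1%:C * b2 + b1), (l1 * l2),
    (fun w => l1 * h2 w + h1 (a2%:C * w + b2)).
  split; first exact: mulr_gt0.
  + by rewrite Re_add Re_scale b20 b10 mulr0 addr0.
  + by rewrite mulf_neq0.
  + rewrite powRM ?ltW// !rmorphM/=.
    transitivity ((a1 `^ mu S)%:C * (l1 * Num.conj l1) *
                  ((a2 `^ mu S)%:C * (l2 * Num.conj l2))); first by ring.
    by rewrite m1 m2 mulr1.
  + move=> p; rewrite /= E1 E2 cw_pt cz_pt; congr pt; rewrite ?rmorphM/=; ring.
(* Inverse: [w] goes to [a^-1 (w - b)], and the fibre equation [z' = l z + h w] is solved for [z],
   with [h] evaluated at the preimage [w]. *)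
- have aC0 : a%:C != 0 :> C by rewrite eq_complex/= gt_eqF.
  exists a^-1, (- (a^-1%:C * b)), l^-1,
    (fun w => - (l^-1 * h (a^-1%:C * w - a^-1%:C * b))).
  split; first by rewrite invr_gt0.
  + by rewrite -mulrN Re_scale; case: b b0 {E} => ? ? /= ->; rewrite oppr0 mulr0.
  + by rewrite invr_eq0.
  + rewrite -powR_inv1 ?ltW// -powRrM mulN1r powRN !fmorphV/= -!invfM m invr1//.
  (* The coordinates of [q] are read off from the formula for [g q], which equals [p]. *)
  + move=> p; set q := g' p.
    have := E q; rewrite g'K => pE.
    have wE : cw q = a^-1%:C * cw p - a^-1%:C * b.
      by rewrite pE cw_pt fmorphV/=; field.
    rewrite -[LHS]ptK; congr pt => //; rewrite -wE pE cz_pt; by field.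
Qed.

Lemma real_complexM (x y : R) : (x * y)%:C = x%:C * y%:C :> C.
Proof. exact: rmorphM. Qed.

Lemma real_complexD (x y : R) : (x + y)%:C = x%:C + y%:C :> C.
Proof. exact: rmorphD. Qed.

Lemma conjC_real (x : R) : Num.conj x%:C = x%:C :> C.
Proof. exact: conjc_real. Qed.

(** Pointwise version of [iwedge]: the matrix attached to a single covector [u]. *)
Definition rank1 (u : 'rV[C]_2) : 'M[C]_2 := u^T *m map_mx Num.conj u.

Lemma rank1Z (l : C) u : rank1 (l *: u) = (l * Num.conj l) *: rank1 u.
Proof.
by rewrite /rank1 linearZ/= map_mxZ -scalemxAl -scalemxAr scalerA.
Qed.

(** Reduces the pullback of a (1,1)-form of this type to that of the underlying (1,0)-form. *)
Lemma pullback_rank1 (J : 'M[C]_2) u :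
  J^T *m rank1 u *m map_mx Num.conj J = rank1 (u *m J).
Proof. by rewrite /rank1 trmx_mul map_mxM !mulmxA. Qed.

Lemma rank1_delta : rank1 (delta_mx 0 0) = delta_mx 0 0.
Proof. by rewrite /rank1 map_delta_mx trmx_delta mul_delta_mx. Qed.

Lemma derive_affine (u : V -> R) (a c : R) v p :
  (forall h q w, u (h *: q + w) = h * u q + u w) ->
  'D_v (fun q => a * u q + c) p = a * u v.
Proof.
move=> lin_u.
have H : is_derive (u p) 1 (fun x : R => a * x + c) a.
  rewrite -[X in is_derive _ _ _ X]addr0 -[X in is_derive _ _ _ (X + _)]mulr1.
  by apply: is_deriveD; apply: is_deriveZ.
by have [_ ->] := is_derive_comp_linear v lin_u H; rewrite mulrC.
Qed.

Lemma cD_affine (a : R) (b : C) v p :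
  cD v (fun q => a%:C * cw q + b) p = a%:C * cw v.
Proof.
rewrite /cD (_ : _ \o _ = fun q : V => a * q.1.1 + re b); last first.
  by apply/funext => q /=; rewrite Re_add Re_scale.
rewrite (_ : im \o _ = fun q : V => a * q.1.2 + im b); last first.
  by apply/funext => q /=; rewrite Im_add Im_scale.
rewrite !(derive_affine (u := fun q : V => q.1.1),
          derive_affine (u := fun q : V => q.1.2))//.
by apply/eqP; rewrite eq_complex/= !mul0r subr0 addr0 !eqxx.
Qed.

(** In terms of forms, [dw] pulls back to [a dw]. This row of the Jacobian is all that [omega_tr]
    sees. *)
Lemma hol_jacobian_row0 (g : V -> V) (a : R) (b l : C) (h : C -> C) p :
  (forall p, g p = pt (a%:C * cw p + b) (l * cz p + h (cw p))) ->
  delta_mx 0 0 *m hol_jacobian g p = a%:C *: delta_mx 0 0 :> 'rV_2.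
Proof.
move=> gE; rewrite -rowE; apply/rowP => j; rewrite !mxE.
have -> : zcoord 0 \o g = fun q => a%:C * cw q + b.
  by apply/funext => q; rewrite /= /zcoord/= gE cw_pt.
rewrite /dhol !cD_affine.
have -> : cw (evec j 1) = (j == 0)%:R :> C.
  by rewrite /evec; case: eqP => _; rewrite cw_pt.
have -> : cw (evec j 'i) = 'i * (j == 0)%:R :> C.
  by rewrite /evec; case: eqP => _; rewrite cw_pt ?mulr1 ?mulr0.
(* The factor [- 'i] in [dhol] meets the ['i] of the second direction, so the two directional
   derivatives contribute equally and cancel the factor one half. *)
have ii (x y : C) : 'i * (x * ('i * y)) = - (x * y).
  by rewrite mulrCA [in X in _ * X]mulrA -expr2 sqr_i mulN1r mulrN.
by rewrite ii opprK/=; field.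
Qed.

Lemma ss_affine (g : V -> V) (a : R) (b l : C) (h : C -> C) p :
  (forall p, g p = pt (a%:C * cw p + b) (l * cz p + h (cw p))) -> re b = 0 ->
  ss (g p) = a * ss p.
Proof. by move=> gE b0; rewrite /ss gE cw_pt Re_add b0 addr0 Re_scale mulrN. Qed.

Lemma deck_XX g p : deck S g -> X p -> X (g p).
Proof.
move=> /deck_affine[a [b [l [h [a0 b0 _ _ gE]]]]] Xp.
have : 0 < ss (g p) by rewrite (ss_affine p gE b0) mulr_gt0 ?ss_gt0.
by rewrite /ss oppr_gt0.
Qed.

(** The factor [a^2] coming from [dw] and its conjugate cancels against [s^-2], since [s] becomes
    [a s]. *)
Lemma pullback11_omega_tr g p : deck S g -> X p ->
  pullback11 g (@omega_tr R) p = omega_tr p.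
Proof.
move=> dg Xp; have := dg.
move=> /deck_affine[a [b [l [h [a0 b0 _ _ gE]]]]].
rewrite /pullback11 !omega_trE//; last exact: deck_XX.
rewrite -rank1_delta -scalemxAr -scalemxAl pullback_rank1.
rewrite (hol_jacobian_row0 p gE) rank1Z scalerA conjC_real.
rewrite -!rmorphM/= (ss_affine p gE b0).
congr (_%:C *: _); have s0 := ss_gt0 Xp.
by field; rewrite !gt_eqF.
Qed.

Lemma pullback11_vertical (B : V -> C) g p : deck S g -> X p ->
  equivariant10 S (vertical_form B) ->
  pullback11 g (fun q => (ss q `^ mu S)%:C *: iwedge (vertical_form B) q) p =
  (ss p `^ mu S)%:C *: iwedge (vertical_form B) p.
Proof.
move=> dg Xp eqB; have := dg.
move=> /deck_affine[a [b [l [h [a0 b0 l0 m gE]]]]].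
(* Equivariance is used with the very multiplier [l] supplied by [deck_affine], hence the one
   satisfying the modulus condition. *)
have lE : pullback10 g (vertical_form B) p = l *: vertical_form B p.
  by apply: (eqB g a b l h dg _ p Xp); split=> // q _; exact: gE.
rewrite /pullback11 -scalemxAr -scalemxAl pullback_rank1.
rewrite -/(pullback10 _ _ _) lE rank1Z scalerA (ss_affine p gE b0).
rewrite powRM ?ltW ?ss_gt0// rmorphM/= -mulrA [_ * (l * _)]mulrC mulrA m mul1r.
by [].
Qed.

End DeckGroup.

(** * Algebra of the metrics: determinant, splitting in time and Ricci form *)

Section Flow.
Variables (R : realType) (S : intermediate_data R).
Local Notation C := R[i].
Local Notation V := ((R * R) * (R * R))%type.
Local Notation re := (@complex.Re R).
Local Notation im := (@complex.Im R).
Local Notation X := (@XX R).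
Variables (B : V -> C) (M : R).
Implicit Types (p : V) (j k : 'I_2) (t : R).

(** The product [v *m a^T] is the pairing of the vector [v] with the covector [a], so the Hermitian
    form is a product of two pairings. *)
Lemma rank1_sesqui (a v u : 'rV[C]_2) :
  (v *m rank1 a *m map_mx Num.conj u^T) 0 0 =
  (v *m a^T) 0 0 * Num.conj ((u *m a^T) 0 0).
Proof.
rewrite /rank1 mulmxA -mulmxA.
have -> : map_mx Num.conj a *m map_mx Num.conj u^T =
          map_mx Num.conj (u *m a^T)^T.
  by rewrite -map_mxM trmx_mul trmxK.
by rewrite mxE big_ord1 [X in _ * X = _]mxE [X in Num.conj X]mxE.
Qed.

Lemma rank1E (a : 'rV[C]_2) j k : rank1 a j k = a 0 j * Num.conj (a 0 k).
Proof. by rewrite mxE big_ord1 !mxE. Qed.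

Lemma rank1_combE (c d : R) (a b : 'rV[C]_2) j k :
  (c%:C *: rank1 a + d%:C *: rank1 b) j k =
  c%:C * (a 0 j * Num.conj (a 0 k)) + d%:C * (b 0 j * Num.conj (b 0 k)).
Proof. by rewrite mxE [X in X + _]mxE [X in _ + X]mxE !rank1E. Qed.

Lemma rank1_hermsym (c d : R) (a b : 'rV[C]_2) :
  c%:C *: rank1 a + d%:C *: rank1 b \is hermsymmx.
Proof.
apply/is_hermitianmxP; rewrite expr0 scale1r; apply/matrixP => j k.
rewrite [RHS]mxE [X in Num.conj X]mxE !rank1_combE.
rewrite [RHS]rmorphD !rmorphM/= !conjCK !conjC_real.
by congr (_ * _ + _ * _); rewrite mulrC.
Qed.

Lemma vertical_formE p j : vertical_form B p 0 j = if j == 0 then B p else 1.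
Proof.
rewrite !mxE !eqxx/=; case: (j =P 0) => [->|/eqP j0]; first by rewrite mulr1 add0r.
rewrite mulr0 addr0; suff -> : j = 1 by [].
by case: j j0 => -[|[]]//= ? _; apply/val_inj.
Qed.

Lemma iwedgeE (th : form10 R) p : iwedge th p = rank1 (th p).
Proof. by []. Qed.

Lemma omega_tr_rank1 p : X p ->
  omega_tr p = (4^-1 * ss p ^- 2)%:C *: rank1 (delta_mx 0 0).
Proof. by move=> Xp; rewrite rank1_delta omega_trE. Qed.

Lemma Omega_rank1 t p : X p -> Omega S B M t p =
  (AA S M t * (4^-1 * ss p ^- 2))%:C *: rank1 (delta_mx 0 0) +
  (expR (- t) * ss p `^ mu S)%:C *: rank1 (vertical_form B p).
Proof.
by move=> Xp; rewrite /Omega (omega_tr_rank1 Xp) scalerA -real_complexM.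
Qed.

Lemma det_mx22 (K : comNzRingType) (A : 'M[K]_2) :
  \det A = A 0 0 * A 1 1 - A 0 1 * A 1 0.
Proof.
rewrite (expand_det_row _ 0) !big_ord_recl big_ord0 addr0 /cofactor !det_mx11.
rewrite !mxE/= !expr0 !expr1 mul1r mulN1r mulrN.
by congr (_ * A _ _ - A _ _ * A _ _); apply/val_inj.
Qed.

(** The determinant is the product of the two coefficients, because [dw] and [Theta] form a
    unimodular coframe: [dw /\ Theta = dw /\ dz]. *)
Lemma det_Omega t p : X p -> \det (Omega S B M t p) =
  (AA S M t * (4^-1 * ss p ^- 2) * (expR (- t) * ss p `^ mu S))%:C.
Proof.
move=> Xp; rewrite det_mx22 Omega_rank1//.
set a := _ * (4^-1 * _); set b := expR _ * _.
rewrite !rank1_combE !vertical_formE !mxE/= [RHS]real_complexM.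
by rewrite conjC1 conjC0; ring.
Qed.

(** [A(t)] is the convex combination of [2 - mu] and [M] with weights [1 - e^-t] and [e^-t]. The
    first weight vanishes at [t = 0], so strictness is taken from [M]. *)
Lemma AA_gt0 t : 0 < M -> mu S < 2 -> 0 <= t -> 0 < AA S M t.
Proof.
move=> M0 mu2 t0.
have e0 := expR_gt0 (- t); have e1 : expR (- t) <= 1.
  by rewrite -expR0 ler_expR oppr_le0.
rewrite (_ : AA _ _ _ = (1 - expR (- t)) * (2 - mu S) + expR (- t) * M).
  by rewrite ltr_wpDl ?mulr_gt0// mulr_ge0 ?subr_ge0// ltW.
by rewrite /AA; ring.
Qed.

Definition Omega_lim : form11 R := fun p => (2 - mu S)%:C *: omega_tr p.

(** The initial value minus the limit. *)
Definition Omega_decay : form11 R := fun p =>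
  (M - (2 - mu S))%:C *: omega_tr p +
  (ss p `^ mu S)%:C *: iwedge (vertical_form B) p.

Lemma Omega_split t p :
  Omega S B M t p = Omega_lim p + (expR (- t))%:C *: Omega_decay p.
Proof.
rewrite /Omega /Omega_lim /Omega_decay /AA scalerDr !scalerA -!real_complexM addrA -scalerDl.
by rewrite -real_complexD.
Qed.

Lemma ricci_Omega t p : 0 < M -> mu S < 2 -> 0 <= t -> X p ->
  chern_ricci (Omega S B M t) p = - Omega_lim p.
Proof.
move=> M0 mu2 t0 Xp; rewrite /chern_ricci; congr (- _).
have A0 := AA_gt0 M0 mu2 t0.
rewrite (@eq_on_iddbar R X _ (fun q => ln (AA S M t * 4^-1 * expR (- t)) +
   (mu S - 2) * ln (ss q)) p (@open_XX R) _ Xp).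
  by rewrite iddbar_ln_ss// /Omega_lim omega_trE// scalerA -real_complexM/= opprB.
move=> q Xq; have s0 := ss_gt0 Xq; rewrite det_Omega//=.
(* The factors constant in space are separated from [s^mu s^-2]; all are positive, so the logarithm
   splits. *)
rewrite (_ : _ * (expR _ * _) = (AA S M t * 4^-1 * expR (- t)) *
   (ss q `^ mu S * ss q ^- 2)); last by ring.
rewrite lnM ?posrE ?mulr_gt0 ?invr_gt0 ?exprn_gt0 ?powR_gt0 ?expR_gt0//.
congr (_ + _); rewrite lnM ?posrE ?invr_gt0 ?exprn_gt0 ?powR_gt0//.
rewrite ln_powR lnV ?posrE ?exprn_gt0// lnXn// mulrBl.
by rewrite mulr_natl.
Qed.

(** * Smoothness, convergence and the flow equation *)

Lemma form11_smoothD U (g h : form11 R) : open U ->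
  form11_smooth_on U g -> form11_smooth_on U h ->
  form11_smooth_on U (fun p => g p + h p).
Proof.
move=> oU sg sh j k; apply: (eq_on_csmooth oU _ (csmooth_onD oU (sg j k) (sh j k))).
by move=> q _; rewrite mxE.
Qed.

Lemma form11_smoothZ U (f : V -> R) (g : form11 R) : open U -> smooth_on U f ->
  form11_smooth_on U g -> form11_smooth_on U (fun p => (f p)%:C *: g p).
Proof.
move=> oU sf sg j k.
apply: (eq_on_csmooth oU _ (csmooth_onM oU (csmooth_on_real oU sf) (sg j k))).
by move=> q _; rewrite mxE.
Qed.

Lemma omega_tr_smooth : form11_smooth_on X (@omega_tr R).
Proof.
have oX := @open_XX R.
(* The factor [s^-2] is rewritten with a real exponent to match [smooth_on_powR]. *)
have sc : smooth_on X (fun p => 4^-1 * ss p `^ (- 2%:R)).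
  exact: smooth_onM oX (smooth_on_cst _ oX) (smooth_on_powR _).
have sd : form11_smooth_on X (fun=> delta_mx 0 0).
  by move=> j k; exact: csmooth_on_cst oX.
move=> j k; apply: (eq_on_csmooth oX _ (form11_smoothZ oX sc sd j k)) => q Xq.
by rewrite omega_trE// powR_invn// ltW// ss_gt0.
Qed.

Hypothesis smooth_B : csmooth_on X B.

Lemma vertical_smooth : form11_smooth_on X
  (fun p => (ss p `^ mu S)%:C *: iwedge (vertical_form B) p).
Proof.
have oX := @open_XX R.
apply: (form11_smoothZ oX (smooth_on_powR _)) => j k.
have s i : csmooth_on X (fun p => vertical_form B p 0 i).
  have si : csmooth_on X (fun p => if i == 0 then B p else 1).
    by case: (i == 0); [exact: smooth_B|exact: csmooth_on_cst oX].
  by apply: (eq_on_csmooth oX _ si) => q _; rewrite vertical_formE.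
apply: (eq_on_csmooth oX _ (csmooth_onM oX (s j) (csmooth_on_conj oX (s k)))).
by move=> q _; rewrite iwedgeE rank1E.
Qed.

Lemma Omega_lim_smooth : form11_smooth_on X Omega_lim.
Proof.
have oX := @open_XX R.
exact: form11_smoothZ oX (smooth_on_cst _ oX) omega_tr_smooth.
Qed.

Lemma Omega_decay_smooth : form11_smooth_on X Omega_decay.
Proof.
have oX := @open_XX R.
apply: (form11_smoothD oX _ vertical_smooth).
exact: form11_smoothZ oX (smooth_on_cst _ oX) omega_tr_smooth.
Qed.

Lemma Omega_smooth t : form11_smooth_on X (Omega S B M t).
Proof.
have oX := @open_XX R.
rewrite (_ : Omega _ _ _ _ = fun p => Omega_lim p + (expR (- t))%:C *: Omega_decay p).
  apply: (form11_smoothD oX Omega_lim_smooth).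
  exact: form11_smoothZ oX (smooth_on_cst _ oX) Omega_decay_smooth.
by apply/funext => p; rewrite Omega_split.
Qed.

Lemma Re_Omega t p j k :
  re (Omega S B M t p j k) = re (Omega_lim p j k) + expR (- t) * re (Omega_decay p j k).
Proof. by rewrite Omega_split [in LHS]mxE Re_add [X in _ + re X]mxE Re_scale. Qed.

Lemma Im_Omega t p j k :
  im (Omega S B M t p j k) = im (Omega_lim p j k) + expR (- t) * im (Omega_decay p j k).
Proof. by rewrite Omega_split [in LHS]mxE Im_add [X in _ + im X]mxE Im_scale. Qed.

Lemma Omega_cvg : cvg_smooth_loc_on X (Omega S B M) Omega_lim.
Proof.
have oX := @open_XX R.
move=> vs j k; split.
  rewrite (_ : (fun t => _) = fun t : R => derivs vs (fun p =>
    re (Omega_lim p j k) + expR (- t) * re (Omega_decay p j k))).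
    exact (cvg_derivs_expN oX (Omega_lim_smooth j k).1 (Omega_decay_smooth j k).1).
  by apply/funext => t; congr derivs; apply/funext => p; exact: Re_Omega.
rewrite (_ : (fun t => _) = fun t : R => derivs vs (fun p =>
  im (Omega_lim p j k) + expR (- t) * im (Omega_decay p j k))).
  exact (cvg_derivs_expN oX (Omega_lim_smooth j k).2 (Omega_decay_smooth j k).2).
by apply/funext => t; congr derivs; apply/funext => p; exact: Im_Omega.
Qed.

(** Substitute [u = t + h] in the two-sided quotient, then restrict to [u >= 0]; this covers the
    one-sided derivative at [t = 0]. *)
Lemma has_time_derivative_is_derive (f : R -> R) (t l : R) :
  is_derive t 1 f l -> has_time_derivative f t l.
Proof.
case=> df fl; rewrite /has_time_derivative.
suff H : (u - t)^-1 * (f u - f t) @[u --> t^'] --> l.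
  by apply: cvg_trans H; apply: cvg_app; exact: cvg_within.
have G : h^-1 *: ((f \o shift t) (h *: 1) - f t) @[h --> 0^'] --> l.
  by rewrite -fl; exact: df.
apply/cvgrPdist_lt => e e0.
have /cvgrPdist_lt /(_ e e0) := G.
rewrite !near_withinE => /nbhs_ballP[r r0 rG]; apply/nbhs_ballP; exists r => //.
move=> u; rewrite /ball/= => tu ut.
have := rG (u - t); rewrite /ball/= sub0r normrN distrC => /(_ tu).
rewrite subr_eq0 => /(_ ut).
by rewrite /shift/= /GRing.scale/= mulr1 subrK.
Qed.

Lemma has_time_derivative_expN (f : R -> R) (c d t : R) :
  (forall u, f u = c + expR (- u) * d) ->
  has_time_derivative f t (- (expR (- t) * d)).
Proof.
move=> fE; apply: has_time_derivative_is_derive.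
have H : is_derive t 1 (cst c + d \*: (expR \o -%R)) (0 + d *: (expR (- t) * -1)).
  by apply: is_deriveD; apply: is_deriveZ; exact: is_derive1_comp.
rewrite (_ : f = cst c + d \*: (expR \o -%R)); last first.
  by apply/funext => u; rewrite fE mulrC.
rewrite (_ : - _ = 0 + d *: (expR (- t) * -1))//.
by rewrite add0r mulrN1 scalerN mulrC.
Qed.

(** Since [- Ric] equals the limit form, subtracting [Omega_t] leaves [- e^-t Omega_decay], which is
    the time derivative of the splitting. *)
Lemma Omega_flow : 0 < M -> mu S < 2 ->
  normalised_chern_ricci_flow_on X (Omega S B M).
Proof.
move=> M0 mu2 t p j k t0 Xp rhs.
have rhsE : rhs = - ((expR (- t))%:C * Omega_decay p j k).
  rewrite /rhs ricci_Omega// Omega_split opprK opprD addNKr.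
  by rewrite mxE mxE.
have -> : re rhs = - (expR (- t) * re (Omega_decay p j k)).
  by rewrite rhsE -Re_scale; case: (_ * _).
have -> : im rhs = - (expR (- t) * im (Omega_decay p j k)).
  by rewrite rhsE -Im_scale; case: (_ * _).
split; apply: has_time_derivative_expN => u; first exact: Re_Omega.
exact: Im_Omega.
Qed.

(** * Descent to the quotient, positivity, and the kernel of the limit *)

Lemma pullback11D g (u v : form11 R) p :
  pullback11 g (fun q => u q + v q) p = pullback11 g u p + pullback11 g v p.
Proof. by rewrite /pullback11 mulmxDr mulmxDl. Qed.

Lemma pullback11Z g (c : C) (u : form11 R) p :
  pullback11 g (fun q => c *: u q) p = c *: pullback11 g u p.
Proof. by rewrite /pullback11 -scalemxAr -scalemxAl. Qed.

Lemma Omega_lim_quotient : quotient_form11 S Omega_lim.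
Proof.
split=> [|g dg p Xp]; first exact: Omega_lim_smooth.
by rewrite pullback11Z (pullback11_omega_tr dg).
Qed.

Hypothesis equivariant_B : equivariant10 S (vertical_form B).

Lemma Omega_quotient t : quotient_form11 S (Omega S B M t).
Proof.
split=> [|g dg p Xp]; first exact: Omega_smooth.
(* The power [s^mu] is kept next to [iwedge Theta], as only their product is invariant; the
   remaining coefficients are constant in space. *)
have -> : Omega S B M t = fun q => (AA S M t)%:C *: omega_tr q +
    (expR (- t))%:C *: ((ss q `^ mu S)%:C *: iwedge (vertical_form B) q).
  by apply/funext => q; rewrite /Omega scalerA -real_complexM.
rewrite pullback11D (pullback11Z g _ (@omega_tr R)).
rewrite (pullback11Z g _ (fun q => (ss q `^ mu S)%:C *: _)).
by rewrite (pullback11_omega_tr dg)// (pullback11_vertical dg).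
Qed.

Lemma vrow_delta (v : 'rV[C]_2) : (v *m (delta_mx 0 0 : 'rV[C]_2)^T) 0 0 = v 0 0.
Proof. by rewrite trmx_delta -colE mxE. Qed.

Lemma row_dotE (v a : 'rV[C]_2) :
  (v *m a^T) 0 0 = v 0 0 * a 0 0 + v 0 1 * a 0 1.
Proof.
rewrite mxE !big_ord_recl big_ord0 addr0 !mxE.
by congr (_ + v _ _ * a _ _); apply/val_inj.
Qed.

Lemma sesquiD (P Q : 'M[C]_2) (c d : C) (v : 'rV_2) (w : 'cV_2) :
  (v *m (c *: P + d *: Q) *m w) 0 0 =
  c * (v *m P *m w) 0 0 + d * (v *m Q *m w) 0 0.
Proof.
rewrite mulmxDr mulmxDl -!scalemxAr -!scalemxAl.
by rewrite mxE [X in X + _]mxE [X in _ + X]mxE.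
Qed.

Lemma Omega_posdef t p : 0 < M -> mu S < 2 -> 0 <= t -> X p ->
  positive_definite_at (Omega S B M t) p.
Proof.
move=> M0 mu2 t0 Xp; have s0 := ss_gt0 Xp.
rewrite /positive_definite_at /hform Omega_rank1//.
set a := _ * (4^-1 * _); set b := expR _ * _.
have a0 : 0 < a%:C :> C.
  by rewrite ltcR !mulr_gt0 ?invr_gt0 ?exprn_gt0// AA_gt0.
have b0 : 0 < b%:C :> C by rewrite ltcR mulr_gt0 ?expR_gt0 ?powR_gt0.
split=> [|v v0]; first exact: rank1_hermsym.
rewrite sesquiD !rank1_sesqui vrow_delta.
set y := (v *m _) 0 0.
have yE : y = v 0 0 * B p + v 0 1.
  by rewrite /y row_dotE !vertical_formE/= mulr1.
rewrite -!normCK.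
(* The value at [v] is [a |v_0|^2 + b |v_0 B + v_1|^2]. If [v_0 = 0], the second term is [b |v_1|^2]
   with [v_1] nonzero; otherwise the first term is already positive. *)
have [v00|v00] := eqVneq (v 0 0) 0.
  rewrite v00 normr0 expr0n/= mulr0 add0r mulr_gt0// exprn_gt0// normr_gt0 yE v00.
  rewrite mul0r add0r; apply: contra v0 => /eqP v01; apply/eqP/rowP => j.
  rewrite mxE; case: j => -[|[]]//= lt; [rewrite -[RHS]v00|rewrite -[RHS]v01];
    by congr (v _ _); apply/val_inj.
by rewrite ltr_pwDl ?mulr_gt0 ?exprn_gt0 ?normr_gt0// mulr_ge0 ?exprn_ge0// ltW.
Qed.

Lemma Omega_lim_semipositive p : mu S < 2 -> X p ->
  [/\ semipositive_at Omega_lim p, \rank (Omega_lim p) = 1%N &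
      form_kernel Omega_lim p = canonical_foliation p].
Proof.
move=> mu2 Xp; have s0 := ss_gt0 Xp.
set c := (2 - mu S) * (4^-1 * ss p ^- 2).
have OE : Omega_lim p = c%:C *: rank1 (delta_mx 0 0).
  by rewrite /Omega_lim omega_tr_rank1// scalerA -real_complexM.
have c0 : 0 < c%:C :> C.
  by rewrite ltcR !mulr_gt0 ?invr_gt0 ?exprn_gt0// subr_gt0.
have hE v u : hform Omega_lim p v u = c%:C * (v 0 0 * Num.conj (u 0 0)).
  by rewrite /hform OE -scalemxAr -scalemxAl mxE rank1_sesqui !vrow_delta.
split.
- split=> [|v].
    (* A term with coefficient zero is added to reach the two-term shape of [rank1_hermsym]. *)
    by rewrite OE -[X in X \is _]addr0 -[X in _ + X](scale0r (rank1 0)) rank1_hermsym.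
  by rewrite hE -normCK mulr_ge0 ?exprn_ge0// ltW.
- by rewrite OE mxrank_scale_nz ?gt_eqF// rank1_delta mxrank_delta.
- apply/seteqP; split=> v.
    (* Testing a kernel vector against [d/dw] isolates its component [v_0]. *)
    move=> /(_ (delta_mx 0 0)) /eqP; rewrite hE mxE eqxx conjC1 mulr1 mulf_eq0 gt_eqF//=.
    by move=> /eqP v00; rewrite /canonical_foliation/= vrow_delta.
  by rewrite /canonical_foliation/= vrow_delta => v00 u; rewrite hE v00 mul0r mulr0.
Qed.

End Flow.

Theorem theorem3 (R : realType) (S : intermediate_data R)
    (B : ((R * R) * (R * R))%type -> R[i]) (M : R) :
  0 < mu S < 2 ->
  equivariant_vertical S B ->
  0 < M ->
  let X := @XX R in
  let Om := Omega S B M in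
  let Om_oo : form11 R := fun p => (2 - mu S)%:C *: omega_tr p in
  [/\ (forall t, 0 <= t -> quotient_hermitian_metric S (Om t)),
      normalised_chern_ricci_flow_on X Om,
      (forall p, X p ->
         Om 0 p = M%:C *: omega_tr p
                  + (ss p `^ mu S)%:C *: iwedge (vertical_form B) p),
      cvg_smooth_loc_on X Om Om_oo &
      quotient_form11 S Om_oo /\
      forall p, X p ->
        [/\ semipositive_at Om_oo p, \rank (Om_oo p) = 1%N &
            form_kernel Om_oo p = canonical_foliation p]].
Proof.
move=> /andP[_ mu2] [smooth_B equivariant_B] M0 X Om Om_lim; split.
- move=> t t0; split=> [|p Xp]; first exact: Omega_quotient.
  exact: Omega_posdef.
- exact: Omega_flow.
(* At time zero [A(0) = (2 - mu) + (M - (2 - mu)) = M]. *)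
- move=> p Xp; rewrite /Om /Omega /AA oppr0 expR0 !mul1r.
  by congr (_%:C *: _ + _); rewrite addrC subrK.
- exact: Omega_cvg.
- split=> [|p Xp]; first exact: Omega_lim_quotient.
  exact: Omega_lim_semipositive.
Qed.
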